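(* Let $G$ be an $(r,s)$-directed hypergraph with at least one arc. Define $$h_G(1/p,1/q):=\log\lambda_{p,q}(G).$$ Then $h_G$ is concave upward (convex) in $(1/p,1/q)$ on the region of real $p,q\ge1$ with $r/p+s/q<1$.
   Context: Let $r,s$ be positive integers. An $(r,s)$-directed hypergraph $G$ consists of a finite vertex set $V(G)$ and a finite set $E(G)$ of arcs. Each arc $e$ is an ordered pair $(T(e),H(e))$ of disjoint subsets of $V(G)$ (tail and head) with $|T(e)|=r$ and $|H(e)|=s$. Write $T(G)=\bigcup_eT(e)$ and $H(G)=\bigcup_eH(e)$. For real vectors $\mathbf{x}=(x_u)_{u\in T(G)}$ and $\mathbf{y}=(y_v)_{v\in H(G)}$, indexed independently, set $P_G(\mathbf x,\mathbf y)=\sum_{e\in E(G)}\prod_{u\in T(e)}x_u\prod_{v\in H(e)}y_v$. For real $p,q\ge1$ let $\lambda_{p,q}(G)=\max\{P_G(\mathbf x,\mathbf y):\|\mathbf x\|_p=\|\mathbf y\|_q=1\}$. *)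

(* Defs.v *)
From HB Require Import structures.
From mathcomp Require Import all_boot all_order all_algebra.
From mathcomp Require Import all_classical all_reals all_analysis.

Set Implicit Arguments.
Unset Strict Implicit.
Unset Printing Implicit Defensive.

Import Order.TTheory GRing.Theory Num.Theory.
Import numFieldNormedType.Exports.

(* An arc is the pair (tail, head). *)
Record dhypergraph (V : finType) (r s : nat) := DHypergraph {
  arcs : {set {set V} * {set V}};
  arcsP : forall e, e \in arcs -> [/\ [disjoint e.1 & e.2], #|e.1| = r & #|e.2| = s]
}.

Definition tails V r s (G : dhypergraph V r s) : {set V} :=
  \bigcup_(e in arcs G) e.1.

Definition heads V r s (G : dhypergraph V r s) : {set V} :=
  \bigcup_(e in arcs G) e.2.

Local Open Scope classical_set_scope.
Local Open Scope ring_scope.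

(* A vertex lying in both T(G) and H(G) indexes an entry of x and, independently,
   an entry of y. *)
Notation tail_vertex G := {u | u \in tails G}.
Notation head_vertex G := {v | v \in heads G}.

(* Since every T(e) is included in T(G) and every H(e) in H(G), the products
   below range over all of T(e) and H(e). *)
Definition dpoly (R : realType) V r s (G : dhypergraph V r s)
    (x : tail_vertex G -> R) (y : head_vertex G -> R) : R :=
  \sum_(e in arcs G)
    (\prod_(u : tail_vertex G | val u \in e.1) x u) *
    (\prod_(v : head_vertex G | val v \in e.2) y v).

Definition pnorm (R : realType) (I : finType) (p : R) (x : I -> R) : R :=
  (\sum_i `|x i| `^ p) `^ p^-1.

Definition dpoly_values (R : realType) V r s (G : dhypergraph V r s) (p q : R) :
    set R :=
  [set z | exists (x : tail_vertex G -> R) (y : head_vertex G -> R),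
    [/\ pnorm p x = 1, pnorm q y = 1 & z = dpoly x y]].

(* The supremum is a maximum, see [spectral_radius_attained]. *)
Definition spectral_radius (R : realType) V r s (G : dhypergraph V r s) (p q : R) : R :=
  sup (dpoly_values G p q).

Section attained.
Variable R : realType.

Let normpowR_continuous (p : R) : 1 <= p -> continuous (fun x : R => `|x| `^ p).
Proof.
move=> p1 x; have p0 : 0 < p by apply: lt_le_trans p1.
have [->|x0] := eqVneq x 0.
  apply/cvgrPdist_lt => /= e e0; rewrite normr0 powR0 ?gt_eqF//.
  near=> y; rewrite sub0r normrN ger0_norm ?powR_ge0//.
  have -> : e = (e `^ p^-1) `^ p by rewrite -powRrM mulVf ?gt_eqF// powRr1// ltW.
  apply: gt0_ltr_powR => //; rewrite ?nnegrE ?powR_ge0//.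
  by near: y; apply: (@nbhs0_lt R R); rewrite powR_gt0.
apply: (@continuous_comp _ _ _ (fun x : R => `|x|) (fun a => a `^ p)).
  exact: norm_continuous.
apply: differentiable_continuous; apply/derivable1_diffP/derivable_powR.
by rewrite in_itv/= andbT normr_gt0.
Unshelve. all: end_near. Qed.

Let pnorm_eq1 (I : finType) (p : R) (x : I -> R) : 1 <= p ->
  pnorm p x = 1 <-> \sum_i `|x i| `^ p = 1.
Proof.
move=> p1; have p0 : 0 < p by apply: lt_le_trans p1.
have s0 : 0 <= \sum_i `|x i| `^ p by apply: sumr_ge0 => i _; exact: powR_ge0.
rewrite /pnorm; split=> [/eqP|->]; last by rewrite powR1.
by rewrite powR_eq1 invr_eq0 (gt_eqF p0) orbF ltNge s0 orbF => /eqP.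
Qed.

Let pnorm_sphere (I : finType) (p : R) : set {ptws I -> R} :=
  [set x | \sum_i `|x i| `^ p = 1].

Let coord_continuous (I : finType) (i : I) :
  continuous (fun x : {ptws I -> R} => x i).
Proof. exact: (@proj_continuous I (fun=> R) i). Qed.

Let addc : continuous (fun z : R * R => z.1 + z.2).
Proof. exact: add_continuous. Qed.

Let mulc : continuous (fun z : R * R => z.1 * z.2).
Proof. exact: mul_continuous. Qed.

Let pnorm_sphere_compact (I : finType) (p : R) : 1 <= p ->
  compact (@pnorm_sphere I p).
Proof.
move=> p1; have p0 : 0 < p by apply: lt_le_trans p1.
pose B : set {ptws I -> R} := [set x | forall i, `[-1, 1]%classic (x i)].
have clA : closed (@pnorm_sphere I p).
  apply: (@preimage_closed {ptws I -> R} R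
    (fun x => \sum_i `|x i| `^ p) [set 1]); last exact: closed_eq.
  move=> x _; apply: (continuous_big addc) => i _ y.
  apply: (@continuous_comp _ _ _ (fun x : {ptws I -> R} => x i)
    (fun a : R => `|a| `^ p)); [exact: coord_continuous|exact: normpowR_continuous].
have cB : compact B.
  exact: (@tychonoff I (fun=> R) (fun=> `[-1, 1]%classic) (fun=> @segment_compact R (-1) 1)).
have AB : pnorm_sphere p `<=` B.
  move=> x /= sx i; rewrite /= in_itv/= -ler_norml leNgt; apply/negP => xi.
  have : 1 < `|x i| `^ p.
    by rewrite -[ltLHS](congr1 (fun g => g p) (@powR1 R)) gt0_ltr_powR// nnegrE.
  rewrite -sx (bigD1 i)//= -[ltRHS]addr0 ltrD2l ltNge.
  by rewrite sumr_ge0// => j _; exact: powR_ge0.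
exact: subclosed_compact clA cB AB.
Qed.

Let pnorm_sphere_neq0 (I : finType) (p : R) (i : I) : 1 <= p ->
  pnorm_sphere p (fun j => (j == i)%:R).
Proof.
move=> p1; rewrite /pnorm_sphere/= (bigD1 i)//= eqxx normr1 powR1 big1 ?addr0//.
move=> j /negbTE ->; rewrite normr0 powR0// gt_eqF//.
exact: lt_le_trans p1.
Qed.

Lemma spectral_radius_attained V r s (G : dhypergraph V r s) (p q : R) :
  (0 < r)%N -> (0 < s)%N -> (exists e, e \in arcs G) -> 1 <= p -> 1 <= q ->
  dpoly_values G p q (spectral_radius G p q) /\
  ubound (dpoly_values G p q) (spectral_radius G p q).
Proof.
move=> r0 s0 [e eG] p1 q1; have [_ cr cs] := arcsP eG.
have /card_gt0P[u ue] : (0 < #|e.1|)%N by rewrite cr.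
have /card_gt0P[v ve] : (0 < #|e.2|)%N by rewrite cs.
have uG : u \in tails G by apply/bigcupP; exists e.
have vG : v \in heads G by apply/bigcupP; exists e.
pose T := ({ptws tail_vertex G -> R} * {ptws head_vertex G -> R})%type.
pose f (z : T) : R := dpoly z.1 z.2.
pose A : set T := pnorm_sphere p `*` pnorm_sphere q.
have A0 : A !=set0.
  exists ((fun j => (j == exist _ u uG)%:R), (fun j => (j == exist _ v vG)%:R)).
  by split; exact: pnorm_sphere_neq0.
have cA : compact A by apply: compact_setX; exact: pnorm_sphere_compact.
have cf : continuous f.
  apply: (continuous_big addc) => a _ z; apply: (@continuousM _ T).
    apply: (continuous_big mulc) => i _ {}z.
    apply: (@continuous_comp _ _ _ (@fst _ _) (fun x : {ptws _ -> R} => x i)).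
      exact: cvg_fst.
    exact: coord_continuous.
  apply: (continuous_big mulc) => i _ {}z.
  apply: (@continuous_comp _ _ _ (@snd _ _) (fun x : {ptws _ -> R} => x i)).
    exact: cvg_snd.
  exact: coord_continuous.
have [[x y]] := compact_EVT_max A0 cA (continuous_subspaceT cf).
rewrite inE => -[/= Ax Ay] ub.
have valS z : dpoly_values G p q z -> z <= dpoly x y.
  move=> [x' [y' [nx ny ->]]]; apply: (ub (x', y')); rewrite inE.
  by split; [exact/(pnorm_eq1 _ p1)|exact/(pnorm_eq1 _ q1)].
have xyS : dpoly_values G p q (dpoly x y).
  by exists x, y; split => //; [exact/(pnorm_eq1 _ p1)|exact/(pnorm_eq1 _ q1)].
suff -> : spectral_radius G p q = dpoly x y by [].
apply/eqP; rewrite eq_le; apply/andP; split.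
  by apply: ge_sup => //; exists (dpoly x y).
by apply: ub_le_sup => //; exists (dpoly x y).
Qed.

End attained.

(* With z = (1/p, 1/q). *)
Definition log_spectral_radius (R : realType) V r s (G : dhypergraph V r s)
    (z : R^o * R^o) : R^o :=
  ln (spectral_radius G z.1^-1 z.2^-1).

Definition exponent_region (R : realType) (r s : nat) : set (R^o * R^o) :=
  [set z | exists p q : R,
    [/\ 1 <= p, 1 <= q, r%:R / p + s%:R / q < 1 & z = (p^-1, q^-1)]].

(* Main.v *)
(* For nonnegative x with ||x||_p = 1, the vector |x|^(p/p') is a unit vector for
   the p'-norm.  If 1/p = t/p1 + (1-t)/p2, then x is the weighted geometric mean
   of the two unit vectors x^(p/p1) and x^(p/p2), and likewise for y; Hoelder's
   inequality for the sum over the arcs bounds P_G(x, y) by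
   lambda_{p1,q1}^t lambda_{p2,q2}^(1-t). *)
Require Import Defs.
From mathcomp Require Import all_boot all_order all_algebra.
From mathcomp Require Import all_classical all_reals all_analysis.
Import Order.TTheory GRing.Theory Num.Theory.
Import numFieldNormedType.Exports.
Local Open Scope classical_set_scope.
Local Open Scope ring_scope.

Set Implicit Arguments.
Unset Strict Implicit.

Section powR_inequalities.
Variable R : realType.
Implicit Types t : R.

Lemma powR_prod (I : finType) (P : pred I) (F : I -> R) t :
  (forall i, 0 <= F i) -> (\prod_(i | P i) F i) `^ t = \prod_(i | P i) F i `^ t.
Proof.
(* Nonnegativity of the partial products is carried through the induction because [powRM] requires
   it. *)
move=> F0; suff [] : (\prod_(i | P i) F i) `^ t = \prod_(i | P i) F i `^ t /\
  0 <= \prod_(i | P i) F i by [].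
apply: (big_ind2 (fun x y => x `^ t = y /\ 0 <= x)) => //.
- by rewrite powR1.
- by move=> x1 x2 y1 y2 [<- x0] [<- y0]; rewrite powRM// mulr_ge0.
Qed.

(** Young's inequality for the conjugate exponents [t^-1] and [(1 - t)^-1], applied to [a^t] and
    [b^(1 - t)]. *)
Lemma powR_weighted_mean (a b t : R) : 0 <= a -> 0 <= b -> 0 < t < 1 ->
  a `^ t * b `^ (1 - t) <= t * a + (1 - t) * b.
Proof.
move=> a0 b0 /andP[t0 t1]; have t1' : 0 < 1 - t by rewrite subr_gt0.
have t1E : t^-1^-1 + (1 - t)^-1^-1 = 1 by rewrite !invrK addrC subrK.
have := conjugate_powR (powR_ge0 a t) (powR_ge0 b (1 - t)) _ _ t1E.
rewrite -!powRrM !invrK !mulfV ?gt_eqF// !powRr1// !invr_gt0.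
by rewrite [a * t]mulrC [b * _]mulrC; exact.
Qed.

(** After division of [f] by [A] and [g] by [B], the weighted mean inequality holds termwise and
    sums to at most t + (1 - t) = 1. Positive upper bounds in place of the sums themselves allow
    this division even when a sum vanishes. *)
Lemma sum_powR_hoelder (I : finType) (P : pred I) (f g : I -> R) (t A B : R) :
  0 < t < 1 -> (forall i, 0 <= f i) -> (forall i, 0 <= g i) ->
  0 < A -> 0 < B -> \sum_(i | P i) f i <= A -> \sum_(i | P i) g i <= B ->
  \sum_(i | P i) f i `^ t * g i `^ (1 - t) <= A `^ t * B `^ (1 - t).
Proof.
move=> t01 f0 g0 A0 B0 fA gB; have /andP[t0 t1] := t01.
have AB0 : 0 < A `^ t * B `^ (1 - t) by rewrite mulr_gt0 ?powR_gt0.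
have termE i : f i `^ t * g i `^ (1 - t) =
    A `^ t * B `^ (1 - t) * ((f i / A) `^ t * (g i / B) `^ (1 - t)).
  by rewrite mulrACA -!powRM ?divr_ge0// 1?ltW// ![_ * (_ / _)]mulrC !divfK ?gt_eqF.
rewrite (eq_bigr _ (fun i _ => termE i)) -mulr_sumr -[leRHS]mulr1.
rewrite ler_pM2l//.
apply: (@le_trans _ _ (\sum_(i | P i) (t * (f i / A) + (1 - t) * (g i / B)))).
  by apply: ler_sum => i _; rewrite powR_weighted_mean// divr_ge0// ltW.
rewrite big_split/= -!mulr_sumr -!mulr_suml -[leRHS](subrK t) addrC lerD//.
- by rewrite ler_piMr ?ler_pdivrMr ?mul1r// subr_ge0 ltW.
- by rewrite ler_piMr ?ler_pdivrMr ?mul1r// ltW.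
Qed.

End powR_inequalities.

Section pnorm.
Variables (R : realType) (I : finType).
Implicit Types (x : I -> R) (p q : R).

Lemma pnorm_eq1 p x : 0 < p -> pnorm p x = 1 <-> \sum_i `|x i| `^ p = 1.
Proof.
move=> p0; rewrite /pnorm; split=> [/eqP|->]; last by rewrite powR1.
have s0 : 0 <= \sum_i `|x i| `^ p by apply: sumr_ge0 => i _; exact: powR_ge0.
by rewrite powR_eq1 invr_eq0 (gt_eqF p0) orbF ltNge s0 orbF => /eqP.
Qed.

Lemma pnorm_powR p q x : 0 < p -> 0 < q -> pnorm p x = 1 ->
  pnorm q (fun i => `|x i| `^ (p / q)) = 1.
Proof.
move=> p0 q0 /(pnorm_eq1 _ p0) x1; apply/(pnorm_eq1 _ q0); rewrite -x1.
apply: eq_bigr => i _.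
by rewrite ger0_norm ?powR_ge0// -powRrM divfK// gt_eqF.
Qed.

(** A unit vector with all entries positive, the test vector for positivity of the spectral
    radius. *)
Lemma pnorm_const p : 0 < p -> (0 < #|I|)%N ->
  pnorm p (fun _ : I => #|I|%:R^-1 `^ p^-1) = 1.
Proof.
move=> p0 I0; apply/(pnorm_eq1 _ p0).
rewrite sumr_const ger0_norm ?powR_ge0// -powRrM mulVf ?gt_eqF//.
by rewrite powRr1 ?invr_ge0// -[LHS]mulr_natr mulVf// pnatr_eq0 -lt0n.
Qed.

End pnorm.

Section spectral_radius.
Variables (R : realType) (V : finType) (r s : nat) (G : dhypergraph V r s).
Implicit Types (x : tail_vertex G -> R) (y : head_vertex G -> R).

(** Reduces the upper bound to nonnegative vectors, on which real powers are multiplicative. *)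
Lemma dpoly_norm_ge x y :
  dpoly x y <= dpoly (fun u => `|x u|) (fun v => `|y v|).
Proof.
apply: ler_sum => e _; rewrite -!normr_prod -normrM; exact: ler_norm.
Qed.

(** The monomial of each arc is the weighted geometric mean of its two monomials, so Hoelder applies
    to the sum over the arcs. *)
Lemma dpoly_powR_hoelder (t A B : R) x1 x2 y1 y2 :
  0 < t < 1 -> 0 < A -> 0 < B ->
  (forall u, 0 <= x1 u) -> (forall u, 0 <= x2 u) ->
  (forall v, 0 <= y1 v) -> (forall v, 0 <= y2 v) ->
  dpoly x1 y1 <= A -> dpoly x2 y2 <= B ->
  dpoly (fun u => x1 u `^ t * x2 u `^ (1 - t))
        (fun v => y1 v `^ t * y2 v `^ (1 - t)) <= A `^ t * B `^ (1 - t).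
Proof.
move=> t01 A0 B0 x10 x20 y10 y20 PA PB.
have arc_ge0 x y (e : {set V} * {set V}) :
    (forall u, 0 <= x u) -> (forall v, 0 <= y v) ->
    0 <= (\prod_(u : tail_vertex G | val u \in e.1) x u) *
         \prod_(v : head_vertex G | val v \in e.2) y v.
  by move=> x0 y0; rewrite mulr_ge0// prodr_ge0.
apply: le_trans (sum_powR_hoelder t01 _ _ A0 B0 PA PB) => [|e|e];
  do ?exact: arc_ge0.
rewrite /dpoly le_eqVlt; apply/predU1P; left; apply: eq_bigr => e _.
by rewrite !powRM ?prodr_ge0// !powR_prod// mulrACA -!big_split.
Qed.

Hypotheses (hr : (0 < r)%N) (hs : (0 < s)%N) (hG : exists e, e \in arcs G).

Lemma dpoly_le_spectral_radius (p q : R) x y : 1 <= p -> 1 <= q ->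
  pnorm p x = 1 -> pnorm q y = 1 -> dpoly x y <= spectral_radius G p q.
Proof.
move=> p1 q1 nx ny; have [_] := spectral_radius_attained hr hs hG p1 q1.
by apply; exists x, y.
Qed.

(** Constant unit vectors give every arc a positive term, and there is an arc. *)
Lemma spectral_radius_gt0 (p q : R) : 1 <= p -> 1 <= q ->
  0 < spectral_radius G p q.
Proof.
move=> p1 q1; have p0 := lt_le_trans ltr01 p1; have q0 := lt_le_trans ltr01 q1.
have [e eG] := hG; have [_ cr cs] := arcsP eG.
(* A tail vertex and a head vertex of [e] make both index types inhabited, as [pnorm_const]
   demands. *)
have /card_gt0P[u ue] : (0 < #|e.1|)%N by rewrite cr.
have /card_gt0P[v ve] : (0 < #|e.2|)%N by rewrite cs.
have uG : u \in tails G by apply/bigcupP; exists e.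
have vG : v \in heads G by apply/bigcupP; exists e.
have T0 : (0 < #|{: tail_vertex G}|)%N by apply/card_gt0P; exists (exist _ u uG).
have H0 : (0 < #|{: head_vertex G}|)%N by apply/card_gt0P; exists (exist _ v vG).
apply: lt_le_trans (dpoly_le_spectral_radius p1 q1
  (pnorm_const p0 T0) (pnorm_const q0 H0)).
have gt0 (e' : {set V} * {set V}) :
    0 < (\prod_(u : tail_vertex G | val u \in e'.1)
          #|{: tail_vertex G}|%:R^-1 `^ p^-1 : R) *
        \prod_(v : head_vertex G | val v \in e'.2)
          #|{: head_vertex G}|%:R^-1 `^ q^-1.
  by rewrite mulr_gt0 ?prodr_gt0// => *; rewrite powR_gt0// invr_gt0 ltr0n.
rewrite /dpoly (bigD1 e)//= ltr_wpDr//; apply: sumr_ge0 => e' _; exact: ltW.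
Qed.

Lemma spectral_radius_le_weighted_mean (t p1 q1 p2 q2 p q : R) :
  0 < t < 1 -> 1 <= p1 -> 1 <= q1 -> 1 <= p2 -> 1 <= q2 -> 1 <= p -> 1 <= q ->
  p^-1 = t / p1 + (1 - t) / p2 -> q^-1 = t / q1 + (1 - t) / q2 ->
  spectral_radius G p q <=
  spectral_radius G p1 q1 `^ t * spectral_radius G p2 q2 `^ (1 - t).
Proof.
move=> t01 p11 q11 p21 q21 p_1 q_1 pE qE.
have [[x [y [nx ny ->]]] _] := spectral_radius_attained hr hs hG p_1 q_1.
have gt0 (c : R) : 1 <= c -> 0 < c by exact: lt_le_trans.
have meanE (c c1 c2 a : R) : 1 <= c -> c^-1 = t / c1 + (1 - t) / c2 -> 0 <= a ->
    a = (a `^ (c / c1)) `^ t * (a `^ (c / c2)) `^ (1 - t).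
  move=> c_1 cE a0; rewrite -!powRrM.
  (* The exponents add up to c * c^-1 = 1; since this is nonzero, [powRD] also covers a = 0. *)
  have cE1 : c / c1 * t + c / c2 * (1 - t) = 1.
    rewrite -!mulrA ![c1^-1 * _]mulrC ![c2^-1 * _]mulrC -mulrDr -cE mulfV//.
    by rewrite gt_eqF ?gt0.
  by rewrite -powRD cE1 ?powRr1// oner_eq0.
apply: le_trans (dpoly_norm_ge _ _) _.
have -> : (fun u => `|x u|) =
    (fun u => (`|x u| `^ (p / p1)) `^ t * (`|x u| `^ (p / p2)) `^ (1 - t)).
  by apply/funext => u; exact: meanE.
have -> : (fun v => `|y v|) =
    (fun v => (`|y v| `^ (q / q1)) `^ t * (`|y v| `^ (q / q2)) `^ (1 - t)).
  by apply/funext => v; exact: meanE.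
apply: dpoly_powR_hoelder => //; do ?[by move=> ?; exact: powR_ge0];
  do ?[exact: spectral_radius_gt0].
- exact: dpoly_le_spectral_radius p11 q11
    (pnorm_powR (gt0 _ p_1) (gt0 _ p11) nx)
    (pnorm_powR (gt0 _ q_1) (gt0 _ q11) ny).
- exact: dpoly_le_spectral_radius p21 q21
    (pnorm_powR (gt0 _ p_1) (gt0 _ p21) nx)
    (pnorm_powR (gt0 _ q_1) (gt0 _ q21) ny).
Qed.

End spectral_radius.

Unset Implicit Arguments.
Set Strict Implicit.

Theorem theorem5p7 (R : realType) (V : finType) (r s : nat)
    (hr : (0 < r)%N) (hs : (0 < s)%N) (G : dhypergraph V r s)
    (hG : exists e, e \in arcs G) :
  convex_function (@exponent_region R r s) (@log_spectral_radius R V r s G).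
Proof.
move=> t z1 z2; rewrite !inE => -[p1 [q1 [p11 q11 _ ->]]] [p2 [q2 [p21 q21 _ ->]]].
(* The endpoints are trivial and are split off because the Hoelder bound is stated for 0 < t < 1. *)
have [->|tN0] := eqVneq t 0%:i01; first by rewrite !conv0.
have [->|tN1] := eqVneq t 1%:i01; first by rewrite !conv1.
have t0 : 0 < t%:num by rewrite lt_neqAle eq_sym tN0 ge0.
have t1 : t%:num < 1 by rewrite lt_neqAle tN1 le1.
have t1' : 0 < 1 - t%:num by rewrite subr_gt0.
(* A weighted mean of reciprocals in (0, 1] stays there, so its inverse is again an admissible
   exponent. *)
have mean_ge1 (c1 c2 : R) : 1 <= c1 -> 1 <= c2 ->
    1 <= (t%:num / c1 + (1 - t%:num) / c2)^-1.
  move=> c11 c21; have c10 := lt_le_trans ltr01 c11.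
  have c20 := lt_le_trans ltr01 c21.
  rewrite invf_ge1 ?addr_gt0 ?divr_gt0//.
  rewrite -[leRHS](subrK t%:num) addrC lerD// ler_piMr ?invf_le1//; exact: ltW.
rewrite /log_spectral_radius convRE /= !invrK.
have lam0 := @spectral_radius_gt0 R V r s G hr hs hG.
(* By positivity of the radii, the convex combination of logarithms is the logarithm of a weighted
   geometric mean, and monotonicity of [ln] leaves the multiplicative inequality. *)
rewrite -!ln_powR -lnM ?posrE ?powR_gt0 ?lam0//.
rewrite ler_ln ?posrE ?mulr_gt0 ?powR_gt0 ?lam0 ?mean_ge1//.
apply: spectral_radius_le_weighted_mean; rewrite ?t0 ?t1 ?invrK ?mean_ge1//.
Qed.
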